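(* Let $s,k,d \in \mathbb{Z}_{>0}$ with $\gcd(s,k)=1$ and $s \ge 2$. Let $H_d(s,k)$ denote the maximum possible hook length of a cell in the Young diagram of an $(s,s+k)$-core with $d$-distinct parts. Then \[ H_d(s,k) = \begin{cases} s-1 &\text{if } k = 1 \text{ or } k,s \leq d, \\ s+k-1 &\text{if } 1 < k \le d < s, \\ B-2 &\text{if } d < k \text{ and } \overline{s}\, \widetilde{s} \bmod k = 1, \\ B-s-1 &\text{if } 1 < \overline{s}\, \widetilde{s} \bmod k \le d < k, \\ B + k - \overline{s}\, \widetilde{s} -1 &\text{if } d < \overline{s}\, \widetilde{s} \bmod k < k-1, \\ B-1 &\text{if } d < \overline{s}\, \widetilde{s} \bmod k = k - 1, \end{cases} \] where \begin{align*} B &= \left\lfloor\frac{s-1}{k}\right\rfloor \left(k + s\widetilde{s}\right) + s\left( \left\lceil\frac{\overline{s}\widetilde{s}-1}{k}\right\rceil + \widetilde{s} - 1\right)+\overline{s}, \\ \overline{s} &= s \bmod k, \\ \widetilde{s} &= \min \{\ell \cdot (\overline{s})^{-1} \bmod k \mid -d \leq \ell \leq d,\ \ell\neq0\}, \end{align*} and $(\overline{s})^{-1}$ denotes the inverse of $\overline{s}$ modulo $k$.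
   Context: A partition is a weakly decreasing tuple of positive integers $\lambda=(\lambda_1,\dots,\lambda_n)$; its Young diagram is the left-justified array with $\lambda_i$ cells in row $i$. The hook of a cell consists of the cell itself, all cells to its right in its row, and all cells below it in its column; the hook length is the number of cells in the hook. An $(s,t)$-core is a partition whose Young diagram has no cell of hook length $s$ or $t$. A partition is $d$-distinct (has $d$-distinct parts) if $\lambda_i-\lambda_{i+1}\ge d$ for all $i\in[n-1]$. Here $a \bmod b$ denotes the remainder of Euclidean division of $a$ by $b$ (in $\{0,\dots,b-1\}$).
   Formalization: In the fifth case the formal value is B + k − (s̄·s̃ mod k) − 1 instead of the printed B + k − s̄·s̃ − 1, which fails when s̄·s̃ > k: for (s,k,d) = (8,13,2) it gives 28, but an (8,21)-core with 2-distinct parts has hook length 41. *)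

(* Defs.v *)
From mathcomp Require Import all_boot all_order all_algebra.

Set Implicit Arguments.
Unset Strict Implicit.
Unset Printing Implicit Defensive.

Import Order.TTheory GRing.Theory Num.Theory.

Definition is_partition (la : seq nat) : bool :=
  sorted geq la && all (leq 1) la.

(* Cells (row, column), both numbered from 0. *)
Definition cells (la : seq nat) : seq (nat * nat) :=
  [seq (i, j) | i <- iota 0 (size la), j <- iota 0 (nth 0 la i)].

Definition in_hook (c c' : nat * nat) : bool :=
  ((c'.1 == c.1) && (c.2 <= c'.2)) || ((c'.2 == c.2) && (c.1 <= c'.1)).

Definition hook_length (la : seq nat) (c : nat * nat) : nat :=
  count (in_hook c) (cells la).

Definition is_core (s t : nat) (la : seq nat) : bool :=
  is_partition la &&
  all (fun c => (hook_length la c != s) && (hook_length la c != t)) (cells la).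

(* [sorted] tests the relation on consecutive parts only. *)
Definition d_distinct (d : nat) (la : seq nat) : bool :=
  sorted (fun a b => b + d <= a) la.

Definition is_max_hook_length (s k d : nat) (h : int) : Prop :=
  (exists la c, [/\ is_core s (s + k) la, d_distinct d la, c \in cells la
                  & h = hook_length la c]) /\
  (forall la c, is_core s (s + k) la -> d_distinct d la -> c \in cells la ->
     ((hook_length la c)%:Z <= h)%R).

(* The representative in {0, ..., k-1}; for k = 1 this is 0. *)
Definition inv_mod (k a : nat) : nat :=
  find (fun x => a * x == 1 %[mod k]) (iota 0 k).

Definition cdivz (m n : int) : int := (- ((- m) %/ n)%Z)%R.

Definition sbar (s k : nat) : nat := s %% k.

Definition nonzero_upto (d : nat) : seq int :=
  [seq Posz l | l <- iota 1 d] ++ [seq (- l%:Z)%R | l <- iota 1 d].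

(* All the remainders are smaller than k, so the default value k of the big
   minimum is never reached when d > 0. *)
Definition stilde (s k d : nat) : nat :=
  \big[minn/k]_(l <- nonzero_upto d)
     `|((l * (inv_mod k (sbar s k))%:Z)%R %% Posz k)%Z|%N.

Definition Bval (s k d : nat) : int :=
  let sb := Posz (sbar s k) in
  let st := Posz (stilde s k d) in
  (((s%:Z - 1) %/ k%:Z)%Z * (k%:Z + s%:Z * st)
   + s%:Z * (cdivz (sb * st - 1) k%:Z + st - 1) + sb)%R.

(* The six conditions are mutually exclusive. They are also exhaustive when
   s >= 2, k, d > 0 and gcd(s, k) = 1; the final 0 is not a hook length.
   The fifth value subtracts the remainder r. The product sbar * stilde, as in
   the printed formula, would be wrong when it exceeds k: (s, k, d) = (8, 13, 2)
   would give 28, while (33, 26, 19, 15, 13, 9, 7, 3, 1) is an (8, 21)-core with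
   2-distinct parts and largest hook length 41. *)
Definition max_hook_formula (s k d : nat) : int :=
  let r := (sbar s k * stilde s k d) %% k in
  let B := Bval s k d in
  (if (k == 1%N) || ((k <= d)%N && (s <= d)%N) then s%:Z - 1
   else if (1 < k <= d)%N && (d < s)%N then s%:Z + k%:Z - 1
   else if (d < k)%N && (r == 1%N) then B - 2%:Z
   else if (1 < r <= d)%N && (d < k)%N then B - s%:Z - 1
   else if (d < r)%N && (r < k.-1)%N then B + k%:Z - r%:Z - 1
   else if (d < r)%N && (r == k.-1) then B - 1
   else 0)%R.

(* Main.v *)
Require Import Defs.
From mathcomp Require Import all_boot all_order all_algebra.
From mathcomp Require Import zify.

Import Order.TTheory GRing.Theory Num.Theory.

Set Implicit Arguments.
Unset Strict Implicit.
Unset Printing Implicit Defensive.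

(** A partition is encoded by its set X of first-column hook lengths.  It is an
    (s, s+k)-core iff 0 is not in X and X is stable under subtracting s and
    s+k, and it is d-distinct iff the elements of X are more than d apart.  So
    the largest hook length is the largest x outside the semigroup generated by
    s and s+k such that no two elements x - a s - c (s+k) >= 0 are at distance
    between 1 and d.

    For d < k such a close pair comes from integers n, m with
    0 < |n s - m k| <= d, and then x >= max(m (s+k), (n+m) s).  This bound is
    monotone in n and m, and the pair n = stilde, together with its least m,
    minimises both coordinates at once; it gives a threshold T.  Conversely any
    x >= T is excluded by that pair, so the answer is the largest gap of the
    semigroup below T: this is T - 1, unless T - 1 is itself a generator
    combination (residue 1 or k-1), in which case it is T - 2. *)

(** * Hook lengths and first-column hook sets *)

Definition conj_part (la : seq nat) (j : nat) : nat := count (ltn j) la.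

(* The hook length of the cell (i, 0), for i < size la. *)
Definition beta (la : seq nat) (i : nat) : nat := nth 0 la i + (size la).-1 - i.

Lemma count_iota_interval a b n : count (fun x => a <= x < b) (iota 0 n) = minn b n - a.
Proof.
elim: n => [|n IH]; first by rewrite minn0.
by rewrite -addn1 iotaD count_cat IH /= add0n; lia.
Qed.

Lemma partition_geq la i j :
  is_partition la -> i <= j -> nth 0 la j <= nth 0 la i.
Proof.
case/andP=> so _ le_ij; case: (ltnP j (size la)) => [lt_j|]; last first.
  by move/(nth_default 0) ->.
apply: (sorted_leq_nth (leT := geq)) => //; rewrite ?inE; last by lia.
  by move=> ? ? ? /=; lia.
by move=> x /=.
Qed.

Lemma partition_gt0 la i : is_partition la -> i < size la -> 0 < nth 0 la i.
Proof. by case/andP=> _ /(all_nthP 0) h /h. Qed.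

Lemma conj_part_prefix la j p :
  p <= size la -> (forall i, i < p -> j < nth 0 la i) ->
  (forall i, p <= i < size la -> nth 0 la i <= j) -> conj_part la j = p.
Proof.
move=> le_p h1 h2; rewrite /conj_part -(cat_take_drop p la) count_cat.
have -> : count (ltn j) (take p la) = p.
  rewrite -[RHS](size_takel le_p); apply/eqP; rewrite -all_count.
  by apply/(all_nthP 0) => i; rewrite size_takel // => lt_i; rewrite nth_take //=; exact: h1.
rewrite (_ : count _ _ = 0) ?addn0 //; apply/eqP; rewrite -leqn0 leqNgt -has_count.
apply/negP=> /(has_nthP 0)[i]; rewrite size_drop nth_drop => lt_i /=.
by rewrite ltnNge h2 //; lia.
Qed.

Lemma conj_partP la j i : is_partition la -> i < size la ->
  (i < conj_part la j) = (j < nth 0 la i).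
Proof.
move=> pa lt_i; pose p := find (fun x => x <= j) la.
have lp : p <= size la by exact: find_size.
have h1 m : m < p -> j < nth 0 la m.
  by move/(before_find 0)/negbT; rewrite -ltnNge.
have h2 m : p <= m < size la -> nth 0 la m <= j.
  case/andP=> pm ml; apply: leq_trans (partition_geq pa pm) _.
  by have /(nth_find 0): has (fun x => x <= j) la by rewrite has_find; exact: leq_ltn_trans ml.
rewrite (conj_part_prefix lp h1 h2); case: (ltnP i p) => [/h1 -> //|h].
by apply/esym/negbTE; rewrite -leqNgt h2 // h lt_i.
Qed.

Lemma mem_cells la i j : ((i, j) \in cells la) = (i < size la) && (j < nth 0 la i).
Proof.
apply/allpairsPdep/andP => [[x [y []]]|[hi hj]].
  by rewrite !mem_iota => /andP[_ hx] /andP[_ hy] [-> ->].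
by exists i, j; rewrite !mem_iota.
Qed.

(** Count the hook row by row: row [i] gives the cell and its arm, each lower row that meets column
    [j] gives one cell, and the rows above give none. *)
Lemma hook_lengthE la i j : is_partition la -> (i, j) \in cells la ->
  hook_length la (i, j) + i + j + 1 = nth 0 la i + conj_part la j.
Proof.
move=> pa; rewrite mem_cells => /andP[hi hj].
have hc : i < conj_part la j by rewrite conj_partP.
have hs : conj_part la j <= size la by exact: count_size.
pose row x := if x == i then nth 0 la i - j else ((i < x) && (x < conj_part la j) : nat).
have rowE x : x < size la ->
    count (in_hook (i, j)) [seq (x, y) | y <- iota 0 (nth 0 la x)] = row x.
  move=> hx; rewrite count_map /row; case: eqP => [->|/eqP ne].
    rewrite -{2}(minnn (nth 0 la i)) -count_iota_interval; apply: eq_in_count => y.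
    by rewrite mem_iota /in_hook /= eqxx; case: eqP; lia.
  rewrite conj_partP //.
  transitivity (count (fun y => j <= y < (if i < x then j.+1 else 0))
    (iota 0 (nth 0 la x))).
    apply: eq_in_count => y _; rewrite /in_hook /= (negPf ne) /=.
    by case: (ltnP i x) => h; lia.
  by rewrite count_iota_interval; case: (ltnP i x) => h /=; lia.
have -> : hook_length la (i, j) = \sum_(0 <= x < size la) row x.
  rewrite /hook_length /cells count_flatten sumnE !big_map /index_iota subn0.
  by apply: eq_big_seq => x; rewrite mem_iota => /andP[_ /rowE].
have sumE n : i < n -> \sum_(0 <= x < n) row x =
    nth 0 la i - j + (minn n (conj_part la j) - i.+1).
  elim: n => // n IH; rewrite ltnS leq_eqVlt big_nat_recr //= => /orP[/eqP <-|lt_in].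
    rewrite big_nat big1 => [|x xi]; last by rewrite /row; case: eqP; lia.
    by rewrite /row eqxx; lia.
  by rewrite (IH lt_in) /row gtn_eqF //; lia.
by rewrite sumE //; lia.
Qed.

Lemma beta_hook la i j : is_partition la -> (i, j) \in cells la ->
  hook_length la (i, j) + (size la + j - conj_part la j) = beta la i.
Proof.
move=> pa hc; have := hook_lengthE pa hc; move: hc; rewrite mem_cells => /andP[hi hj].
have : conj_part la j <= size la by exact: count_size.
by rewrite /beta; lia.
Qed.

(* The numbers size la + j - conj_part la j enumerate the complement of X, so by
   beta_hook the hook lengths in row i are the differences between beta la i and
   the smaller numbers outside X. *)
Lemma conj_part_not_beta la j i : is_partition la -> i < size la ->
  beta la i != size la + j - conj_part la j.
Proof.
move=> pa hi; have := conj_partP j pa hi.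
have : conj_part la j <= size la by exact: count_size.
rewrite /beta; case: (ltnP i (conj_part la j)); case: (ltnP j (nth 0 la i)) => //; lia.
Qed.

Lemma beta_anti la i j : is_partition la -> i < j < size la -> beta la j < beta la i.
Proof.
move=> pa hij; have : nth 0 la j <= nth 0 la i by apply: partition_geq => //; lia.
by rewrite /beta; lia.
Qed.

Definition betas la := mkseq (beta la) (size la).

Lemma mem_betasP la x :
  reflect (exists2 i, i < size la & x = beta la i) (x \in betas la).
Proof.
apply: (iffP mapP) => [[i]|[i hi ->]]; first by rewrite mem_iota; exists i.
by exists i; rewrite ?mem_iota.
Qed.

Lemma exists_hook la i y : is_partition la -> i < size la -> y < beta la i ->
  y \notin betas la ->
  exists2 j, (i, j) \in cells la & hook_length la (i, j) + y = beta la i.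
Proof.
move=> pa hi hy /mem_betasP ny.
(* Since [beta la] decreases, [p] is the number of elements of X above [y]. The column sought is the
   number of non-members of X below [y], namely [y - (size la - p)]. *)
pose p := find (fun m => beta la m < y) (iota 0 (size la)).
have lp : p <= size la by rewrite -[leqRHS](size_iota 0) find_size.
have h1 m : m < p -> y < beta la m.
  move=> mp; have /negbT := before_find 0 mp; rewrite nth_iota; last by lia.
  by rewrite -leqNgt leq_eqVlt => /orP[/eqP e|//]; case: ny; exists m => //; lia.
have h2 m : p <= m < size la -> beta la m < y.
  case/andP=> pm ml.
  have : has (fun m => beta la m < y) (iota 0 (size la)).
    by rewrite has_find size_iota; lia.
  move/(nth_find 0); rewrite nth_iota ?add0n; last by rewrite -/p; lia.
  rewrite -/p => hp; move: pm; rewrite leq_eqVlt => /orP[/eqP <- //|pm].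
  by have := @beta_anti la p m pa; rewrite pm ml => /(_ isT); lia.
have ip : i < p by rewrite ltnNge; apply/negP => h; have := h2 i; rewrite h hi => /(_ isT); lia.
have yp : size la - p <= y.
  case: (ltnP p (size la)) => [lt|]; last by lia.
  have := h2 p; rewrite leqnn lt => /(_ isT); have := partition_gt0 pa lt; rewrite /beta.
  by lia.
pose j := y - (size la - p).
have cj : conj_part la j = p.
  apply: conj_part_prefix => // m hm; last first.
    have [hp1 hp2] : p < size la /\ p <= m by lia.
    have := h2 p; rewrite leqnn hp1 => /(_ isT).
    by have := partition_geq pa hp2; rewrite /beta /j; lia.
  have hm2 : m <= p.-1 by lia.
  have /h1 : p.-1 < p by lia.
  by have := partition_geq pa hm2; rewrite /beta /j; lia.
have cell : (i, j) \in cells la by rewrite mem_cells hi -conj_partP // cj.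
exists j => //; rewrite -(beta_hook pa cell) cj; congr (_ + _).
by rewrite /j; lia.
Qed.

(* P need not be finite: core_set_hook truncates it at the chosen element. *)
Definition core_set s k d (P : pred nat) :=
  [/\ ~~ P 0, forall x, P x -> s <= x -> P (x - s),
      forall x, P x -> s + k <= x -> P (x - (s + k))
    & forall x y, P x -> P y -> x < y -> d < y - x].

(** If subtracting [u] led out of X, [exists_hook] would produce a cell of hook length [u].
    Consecutive elements of X differ by one more than the corresponding parts, which turns
    [d]-distinctness into gaps larger than [d]. *)
Lemma core_set_betas s k d la : 0 < s -> is_core s (s + k) la -> d_distinct d la ->
  core_set s k d (mem (betas la)).
Proof.
move=> s0 /andP[pa /allP co] dd.
have closed u x : 0 < u -> (forall c, c \in cells la -> hook_length la c != u) ->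
    x \in betas la -> u <= x -> x - u \in betas la.
  move=> u0 hu /mem_betasP[i hi ->] le_u; apply/negPn/negP => nx.
  have [|j cj e] := exists_hook pa hi _ nx; first by lia.
  by have := hu _ cj; lia.
split=> /=.
- apply/mem_betasP => -[i hi]; have := partition_gt0 pa hi; rewrite /beta; lia.
- by move=> x; apply: closed => // c /co /andP[].
- by move=> x; apply: closed => [|c /co /andP[]//]; lia.
move=> x y /mem_betasP[i hi ->] /mem_betasP[j hj ->] lt_xy.
have ji : j < i.
  rewrite ltnNge leq_eqVlt; apply/negP => /orP[/eqP e|h]; first by rewrite e in lt_xy; lia.
  by have := @beta_anti la i j pa; rewrite h hj => /(_ isT); lia.
have hi' : nth 0 la i <= nth 0 la j.+1 by apply: partition_geq.
have := (sortedP 0 dd) j; rewrite (leq_ltn_trans ji hi) => /(_ isT).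
by rewrite /beta; lia.
Qed.

Lemma hook_length_le_beta s k d la c : 0 < s -> is_core s (s + k) la ->
  d_distinct d la -> c \in cells la ->
  exists P x, [/\ core_set s k d P, P x & hook_length la c <= x].
Proof.
case: c => i j s0 co dd hc; have /andP[pa _] := co.
exists (mem (betas la)), (beta la i); split; first exact: core_set_betas.
  by apply/mem_betasP; exists i => //; move: hc; rewrite mem_cells => /andP[].
by have := beta_hook pa hc; lia.
Qed.

(** Inverts the encoding: cut [P] off at [x], list it in decreasing order and subtract the staircase
    [n.-1 - i]. The head [x] becomes the hook length of the corner cell. *)
Lemma core_set_hook s k d P x : 0 < s -> core_set s k d P -> P x ->
  exists la c, [/\ is_core s (s + k) la, d_distinct d la, c \in cells la
                  & hook_length la c = x].
Proof.
move=> s0 [P0 Ps Pt Pd] Px.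
pose X := rev [seq y <- iota 0 x.+1 | P y]; pose n := size X.
have memX y : (y \in X) = P y && (y <= x).
  by rewrite mem_rev mem_filter mem_iota.
have Xs : sorted gtn X.
  by rewrite rev_sorted; apply: (sorted_filter ltn_trans); exact: iota_ltn_sorted.
have PX i : i < n -> P (nth 0 X i).
  by move=> hi; have := mem_nth 0 hi; rewrite memX => /andP[].
have Xgap i : i.+1 < n -> nth 0 X i.+1 + d < nth 0 X i.
  move=> hi; have lt := (sortedP 0 Xs) i hi.
  by have := Pd _ _ (PX _ hi) (PX i (ltnW hi)) lt; move: lt => /=; lia.
(* As 0 is absent, the element with [m] smaller ones in [X] exceeds [m]; hence the parts are
   positive. *)
have Xlow m : m < n -> m < nth 0 X (n.-1 - m).
  elim: m => [|m IH] hm.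
    rewrite lt0n; apply/eqP => z; have /PX : n.-1 - 0 < n by lia.
    by rewrite z (negPf P0).
  have := IH (ltnW hm); have := Xgap (n.-1 - m.+1).
  have -> : (n.-1 - m.+1).+1 = n.-1 - m by lia.
  by move=> /(_ ltac:(lia)); lia.
have Xlow' i : i < n -> n.-1 - i < nth 0 X i.
  move=> hi; have := Xlow (n.-1 - i); rewrite (_ : n.-1 - (n.-1 - i) = i); last by lia.
  by apply; lia.
pose la := mkseq (fun i => nth 0 X i - (n.-1 - i)) n.
have laE i : i < n -> nth 0 la i = nth 0 X i - (n.-1 - i) by exact: nth_mkseq.
have szla : size la = n by exact: size_mkseq.
have dd : d_distinct d la.
  apply/(sortedP 0) => i; rewrite szla => hi; rewrite !laE //; last by lia.
  by have := Xgap i hi; have := Xlow' i.+1 hi; lia.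
have pa : is_partition la.
  apply/andP; split; first by apply: sub_sorted dd => a b /=; lia.
  apply/(all_nthP 0) => i; rewrite szla => hi; rewrite laE //.
  by have := Xlow' i hi; lia.
have betaE i : i < n -> beta la i = nth 0 X i.
  by move=> hi; rewrite /beta szla laE //; have := Xlow' i hi; lia.
have notX j : size la + j - conj_part la j \notin X.
  apply/negP => /(nthP 0)[i hi]; rewrite -betaE // => e.
  by have := @conj_part_not_beta la j i pa; rewrite szla hi -szla e eqxx => /(_ isT).
(* A hook of length [u] in row [i] makes [nth 0 X i - u] a non-member of [X] by [notX], while
   closure under subtracting [u] makes it a member. *)
have nohook u i j : (forall z, P z -> u <= z -> P (z - u)) -> (i, j) \in cells la ->
    hook_length la (i, j) != u.
  move=> Pu hc; apply/eqP => hu; have := beta_hook pa hc; have := notX j.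
  move: hc; rewrite mem_cells szla => /andP[hi _]; rewrite hu betaE // => nx e.
  have Xi : nth 0 X i \in X by exact: mem_nth.
  rewrite memX in Xi; case/andP: Xi => Pi le_x.
  case/negP: nx; rewrite memX; apply/andP; split; last by lia.
  have := Pu _ Pi; rewrite -e; set w := (X in u + X).
  by rewrite addKn; apply; lia.
have Xx : x \in X by rewrite memX Px leqnn.
have n0 : 0 < n by rewrite /n; case: (X) Xx.
have Xhead : nth 0 X 0 = x.
  have := mem_nth 0 n0; rewrite memX => /andP[_ le_x].
  have /(nthP 0)[i hi ei] := Xx.
  apply/eqP; rewrite eqn_leq le_x -ei.
  apply: (sorted_leq_nth (leT := geq)) => //=; rewrite ?inE //.
  - by move=> a b c /=; lia.
  - by move=> a /=.
  - by apply: sub_sorted Xs => a b /=; lia.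
have cell : (0, 0) \in cells la.
  by rewrite mem_cells szla n0; apply: partition_gt0; rewrite ?szla.
exists la, (0, 0); split=> //.
  rewrite /is_core pa; apply/allP => -[i j] hc.
  by apply/andP; split; apply: nohook hc.
have := beta_hook pa cell; rewrite betaE // Xhead.
rewrite (@conj_part_prefix la 0 n) ?szla ?addn0 ?subnn //; first by rewrite addn0.
  by move=> i hi; apply: partition_gt0; rewrite ?szla.
by move=> i; lia.
Qed.

Lemma core_set_sub s k d P x a c : core_set s k d P -> P (x + a * s + c * (s + k)) -> P x.
Proof.
move=> [_ Ps Pt _]; elim: c => [|c IH]; last first.
  rewrite mulSn => /Pt h; apply: IH; move: (h ltac:(lia)).
  by have -> : x + a * s + (s + k + c * (s + k)) - (s + k) = x + a * s + c * (s + k) by lia.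
rewrite mul0n addn0; elim: a => [|a IH]; first by rewrite mul0n addn0.
rewrite mulSn => /Ps h; apply: IH; move: (h ltac:(lia)).
by have -> : x + (s + a * s) - s = x + a * s by lia.
Qed.

(** These are the elements forced into any core set containing [x]. For [s > 0] the bound on [a] and
    [c] loses nothing and makes the predicate boolean. *)
Definition reach s k x y :=
  [exists a : 'I_x.+1, exists c : 'I_x.+1, x == y + a * s + c * (s + k)].

Lemma reachP s k x y : 0 < s ->
  reflect (exists a c, x = y + a * s + c * (s + k)) (reach s k x y).
Proof.
move=> s0; apply: (iffP existsP) => [[a /existsP[c /eqP ->]]|[a [c e]]].
  by exists a, c.
have ha : a < x.+1.
  rewrite ltnS e; apply: leq_trans (leq_addr _ _).
  by apply: leq_trans (leq_addl _ _); rewrite leq_pmulr.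
have hc : c < x.+1.
  by rewrite ltnS e; apply: leq_trans (leq_addl _ _); rewrite leq_pmulr // addn_gt0 s0.
by exists (Ordinal ha); apply/existsP; exists (Ordinal hc); rewrite -e.
Qed.

Lemma core_set_reach s k d x : 0 < s ->
  (forall a c, x <> a * s + c * (s + k)) ->
  (forall y y' a c a' c', x = y + a * s + c * (s + k) ->
     x = y' + a' * s + c' * (s + k) -> ~~ (y < y' <= y + d)) ->
  core_set s k d (reach s k x).
Proof.
move=> s0 h0 hd; split.
- by apply/(reachP _ _ _ s0) => -[a [c e]]; apply: (h0 a c); rewrite e.
- move=> y /(reachP _ _ _ s0)[a [c e]] h; apply/(reachP _ _ _ s0).
  by exists a.+1, c; rewrite e mulSn; lia.
- move=> y /(reachP _ _ _ s0)[a [c e]] h; apply/(reachP _ _ _ s0).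
  by exists a, c.+1; rewrite e mulSn; lia.
move=> y y' /(reachP _ _ _ s0)[a [c e]] /(reachP _ _ _ s0)[a' [c' e']] lt.
by have := hd _ _ _ _ _ _ e e'; lia.
Qed.

(** The first two conditions make [reach s k H] a core set, so [H] is attained; the third bounds
    every first-column hook length, hence every hook length. *)
Lemma is_max_hook_lengthI s k d (H : nat) : 0 < s ->
  (forall a c, H <> a * s + c * (s + k)) ->
  (forall y y' a c a' c', H = y + a * s + c * (s + k) ->
     H = y' + a' * s + c' * (s + k) -> ~~ (y < y' <= y + d)) ->
  (forall P x, core_set s k d P -> P x -> x <= H) ->
  is_max_hook_length s k d (Posz H).
Proof.
move=> s0 h0 hd hP; split.
  have [|la [c [h1 h2 h3 h4]]] := core_set_hook (x := H) s0 (core_set_reach s0 h0 hd).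
    by apply/(reachP _ _ _ s0); exists 0, 0; rewrite !mul0n !addn0.
  by exists la, c; split=> //; rewrite h4.
move=> la c co dd hc; have [P [x [cP Px le]]] := hook_length_le_beta s0 co dd hc.
by have := hP P x cP Px; lia.
Qed.

(** * Close multiples and gaps of the semigroup *)

Section ClosePairs.

Variables (s k d st m0 : nat).
Hypotheses (s_ge2 : 2 <= s) (d_ltk : d < k) (st_gt0 : 0 < st)
  (st_ltk : st < k).

Definition close_multiples n m l :=
  0 < l <= d /\ (n * s = m * k + l \/ n * s + l = m * k).

Hypothesis st_min : forall n m l, close_multiples n m l -> st <= n.

Section MinimalMultiple.

(* m0 is the least m such that st * s is close to m * k: the first alternative is
   preferred, and e + d < k says that it fails in the second. *)
Hypothesis m0_case : (exists2 r, 0 < r <= d & st * s = m0 * k + r) \/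
  (exists2 e, 0 < e <= d & e + d < k /\ st * s + e = m0 * k).

(** If [m < m0], then [st * s <= n * s <= m * k + d <= m0 * k - k + d]. This contradicts [d < k] in
    the first case of [m0_case] and [e + d < k] in the second. *)
Lemma close_multiples_ge n m l : close_multiples n m l -> m0 <= m.
Proof.
clear st_ltk st_gt0 s_ge2.
move=> cl; have := st_min cl; case: cl => hl nm le_st; rewrite leqNgt; apply/negP => lt_m.
have : st * s <= n * s by rewrite leq_mul2r le_st orbT.
have : m * k + k <= m0 * k by rewrite -mulSnr leq_mul2r lt_m orbT.
by case: m0_case => [[r hr e]|[r hr [h e]]]; lia.
Qed.

Definition threshold := maxn (m0 * (s + k)) ((st + m0) * s).

Lemma close_pair_threshold x y y' a c a' c' :
  x = y + a * s + c * (s + k) -> x = y' + a' * s + c' * (s + k) ->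
  y < y' <= y + d -> threshold <= x.
Proof.
clear st_ltk st_gt0 s_ge2.
move=> e e' hy.
have key n m l u v : close_multiples n m l -> m <= u -> u <= v ->
    u * (s + k) <= x -> (n + v) * s <= x -> threshold <= x.
  move=> cl mu uv h1 h2; have nst := st_min cl; have m0m := close_multiples_ge cl.
  rewrite geq_max (leq_trans _ h1) ?(leq_trans _ h2) //.
    by rewrite leq_mul2r; apply/orP; right; lia.
  by rewrite leq_mul2r (leq_trans m0m mu) orbT.
pose l := y' - y; have l_ok : 0 < l <= d by lia.
(* Grouped this way, the differences of the step totals [a + c], [a' + c'] and of [c], [c'] form a
   close pair. Equal totals would make [l] a positive multiple of [k], against [l <= d < k]. *)
have E : (a + c) * s + c * k = l + (a' + c') * s + c' * k by lia.
case: (ltngtP (a + c) (a' + c')) => hN.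
- have [n en] : exists n, a' + c' = a + c + n by exists (a' + c' - (a + c)); lia.
  have Ec : c * k = l + n * s + c' * k by rewrite en in E; lia.
  have cc : c' <= c.
    rewrite leqNgt; apply/negP => h.
    have : c * k <= c' * k by rewrite leq_mul2r ltnW ?orbT.
    by lia.
  have [m em] : exists m, c = c' + m by exists (c - c'); lia.
  have cl : close_multiples n m l by split=> //; right; rewrite em in Ec; lia.
  by apply: (key n m l c (a + c)) cl _ _ _ _; lia.
- have [n en] : exists n, a + c = a' + c' + n by exists (a + c - (a' + c')); lia.
  have Ec : n * s + c * k = l + c' * k by rewrite en in E; lia.
  have cc : c <= c'.
    rewrite leqNgt; apply/negP => h; have : c'.+1 * k <= c * k by rewrite leq_mul2r h orbT.
    by rewrite mulSn; lia.
  have [m em] : exists m, c' = c + m by exists (c' - c); lia.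
  have cl : close_multiples n m l by split=> //; left; rewrite em in Ec; lia.
  by apply: (key n m l c' (a' + c')) cl _ _ _ _; lia.
- have Ec : c * k = l + c' * k by rewrite hN in E; lia.
  have cc : c' < c.
    rewrite ltnNge; apply/negP => h.
    have : c * k <= c' * k by rewrite leq_mul2r h orbT.
    by lia.
  have : c'.+1 * k <= c * k by rewrite leq_mul2r cc orbT.
  by rewrite mulSn; lia.
Qed.

End MinimalMultiple.

(** Cancelling [s] modulo [k] gives [n] congruent to [2 * st]; if [0 < n < 2 * st <= k], the
    difference would lie strictly between 0 and [k]. *)
Lemma double_st_le n z : coprime s k -> 0 < n -> 2 * st <= k ->
  n * s = 2 * st * s + z * k \/ n * s + z * k = 2 * st * s -> 2 * st <= n.
Proof.
clear st_min st_ltk d_ltk s_ge2.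
move=> co n_gt0 st2 h; rewrite leqNgt; apply/negP => lt_n.
have : k %| (2 * st - n) * s.
  case: h => h; last first.
    by rewrite mulnBl -h addnC addnK dvdn_mull.
  have : n * s <= 2 * st * s by rewrite leq_mul2r ltnW ?orbT.
  by move=> h2; have -> : (2 * st - n) * s = 0 by rewrite mulnBl; lia.
rewrite Gauss_dvdl 1?coprime_sym // => /dvdn_leq; lia.
Qed.

(** A representation yields [n * s = c * k + j] with [a + c + n = st + m0]. If [j <= d], minimality
    forces [n = st] and [c = m0], so [j = r]. If [j = 2] and [d = 1], then [n] and [c] are at least
    twice [st] and [m0], which is too large. *)
Lemma threshold_minus_gap_above r j a c : st * s = m0 * k + r -> 0 < r <= d ->
  0 < j -> j != r -> j <= d \/ (d = 1 /\ j = 2 /\ coprime s k) ->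
  (st + m0) * s <> j + a * s + c * (s + k).
Proof.
clear s_ge2.
move=> e hr j0 jr jd E.
have hN : a + c < st + m0.
  rewrite ltnNge; apply/negP => h.
  have : (st + m0) * s <= (a + c) * s by rewrite leq_mul2r h orbT.
  lia.
have [n [n0 en]] : exists n, 0 < n /\ st + m0 = a + c + n by exists (st + m0 - (a + c)); lia.
have En : n * s = c * k + j by rewrite en in E; lia.
case: jd => [jd|[d1 [j2 co]]].
  have cl : close_multiples n c j by split; [lia | left].
  have h1 := st_min cl; have h2 : m0 <= c.
    by apply: close_multiples_ge cl; left; exists r.
  have en' : n = st by lia.
  have ec : c = m0 by lia.
  by rewrite en' ec in En; lia.
have r1 : r = 1 by lia.
have m0s : m0 <= s.
  rewrite leqNgt; apply/negP => h.
  have : s.+1 * k <= m0 * k by rewrite leq_mul2r h orbT.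
  have : st * s <= k * s by rewrite leq_mul2r ltnW ?orbT.
  by rewrite mulSn; lia.
have m0sk : m0 * k <= s * k by rewrite leq_mul2r m0s orbT.
have stks : st * s <= k * s by rewrite leq_mul2r ltnW ?orbT.
(* The complementary multiple [(k - st) * s] is 1 below [(s - m0) * k], so minimality applies to
   [k - st]. *)
have st2 : 2 * st <= k.
  suff : st <= k - st by lia.
  apply: (st_min (m := s - m0) (l := 1)); split; first by lia.
  by right; rewrite !mulnBl; lia.
have n2 : 2 * st <= n.
  case: (leqP (2 * m0) c) => h.
    apply: (@double_st_le n (c - 2 * m0)) => //; left; rewrite mulnBl.
    have : 2 * m0 * k <= c * k by rewrite leq_mul2r h orbT.
    by lia.
  apply: (@double_st_le n (2 * m0 - c)) => //; right; rewrite mulnBl.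
  have : c * k <= 2 * m0 * k by rewrite leq_mul2r ltnW ?orbT.
  by lia.
have c2 : 2 * m0 <= c.
  have : 2 * st * s <= n * s by rewrite leq_mul2r n2 orbT.
  move=> h; have : 2 * m0 * k <= c * k by lia.
  by rewrite leq_mul2r; lia.
by lia.
Qed.

Lemma threshold_minus_gap_below e j a c : st * s + e = m0 * k -> 0 < e <= d ->
  e + d < k -> 0 < j <= 2 -> j != e -> j <= d \/ (d = 1 /\ coprime s k) ->
  m0 * (s + k) <> j + a * s + c * (s + k).
Proof.
move=> eq he hek j0 je jd E.
have cm : c <= m0.
  rewrite leqNgt; apply/negP => h.
  have : m0 * (s + k) <= c * (s + k) by rewrite leq_mul2r ltnW ?orbT.
  lia.
have [m em] : exists m, m0 = c + m by exists (m0 - c); lia.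
have Em : m * s + m * k = j + a * s by rewrite em in E; lia.
case: (leqP m a) => [ma|am]; last first.
  have : a.+1 * s <= m * s by rewrite leq_mul2r am orbT.
  have : 1 * k <= m * k by rewrite leq_mul2r; lia.
  by rewrite mulSn; lia.
have [n en] : exists n, a = m + n by exists (a - m); lia.
have En : n * s + j = m * k by rewrite en in Em; lia.
have m0c : (exists2 r, 0 < r <= d & st * s = m0 * k + r) \/
  (exists2 e, 0 < e <= d & e + d < k /\ st * s + e = m0 * k) by right; exists e.
case: (leqP j d) => jd'.
  have cl : close_multiples n m j by split; [lia | right].
  have h1 := st_min cl; have h2 := close_multiples_ge m0c cl.
  have mm : m = m0 by lia.
  (* Equality gives [j = e]. Otherwise [s <= e - j], so [s] itself is close to 0 and [st = 1]; then
     [s + e] is a positive multiple of [k], against [e + d < k]. *)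
  have [eqn|ltn] : n = st \/ st < n by lia.
    by subst n; rewrite mm in En; lia.
  have h3 : st.+1 * s <= n * s by rewrite leq_mul2r ltn orbT.
  rewrite mm mulSn in En h3.
  have sd : s <= d by lia.
  have st1 : st <= 1 by apply: (st_min (m := 0) (l := s)); split; [lia|left; lia].
  have {}st1 : st = 1 by lia.
  rewrite st1 in eq.
  have : m0 != 0 by apply/eqP => z; rewrite z in eq; lia.
  move=> z; have : 1 * k <= m0 * k by rewrite leq_mul2r; lia.
  by lia.
have [d1 co] : d = 1 /\ coprime s k by lia.
have j2 : j = 2 by lia.
have e1 : e = 1 by lia.
have m0s : m0 <= s.
  rewrite leqNgt; apply/negP => h.
  have : s.+1 * k <= m0 * k by rewrite leq_mul2r h orbT.
  have : st * s <= k * s by rewrite leq_mul2r ltnW ?orbT.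
  by rewrite mulSn; lia.
have m0sk : m0 * k <= s * k by rewrite leq_mul2r m0s orbT.
have stks : st * s <= k * s by rewrite leq_mul2r ltnW ?orbT.
have st2 : 2 * st <= k.
  suff : st <= k - st by lia.
  apply: (st_min (m := s - m0) (l := 1)); split; first by lia.
  by left; rewrite !mulnBl; lia.
have n0 : 0 < n.
  rewrite lt0n; apply/eqP => z; rewrite z j2 in En.
  have : m != 0 by apply/eqP => zm; rewrite zm in En; lia.
  move=> zm; have : 1 * k <= m * k by rewrite leq_mul2r; lia.
  by lia.
have n2 : 2 * st <= n.
  case: (leqP (2 * m0) m) => h.
    apply: (@double_st_le n (m - 2 * m0)) => //; left; rewrite mulnBl.
    have : 2 * m0 * k <= m * k by rewrite leq_mul2r h orbT.
    by lia.
  apply: (@double_st_le n (2 * m0 - m)) => //; right; rewrite mulnBl.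
  have : m * k <= 2 * m0 * k by rewrite leq_mul2r ltnW ?orbT.
  by lia.
have : 2 * st * s <= n * s by rewrite leq_mul2r n2 orbT.
move=> h; have h4 : 2 * m0 * k <= m * k by lia.
have : 2 * m0 <= m by move: h4; rewrite leq_mul2r; lia.
move=> h5; have m00 : m0 = 0 by lia.
by rewrite m00 in eq; lia.
Qed.

End ClosePairs.

(** * The residue stilde and the value of B *)

Lemma bigminn_le (I : eqType) (L : seq I) (F : I -> nat) k l :
  l \in L -> \big[minn/k]_(i <- L) F i <= F l.
Proof.
elim: L => // i L IH; rewrite inE big_cons => /orP[/eqP ->|/IH h]; first exact: geq_minl.
exact: leq_trans (geq_minr _ _) h.
Qed.

Lemma bigminn_attained (I : eqType) (L : seq I) (F : I -> nat) k :
  \big[minn/k]_(i <- L) F i = k \/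
  exists2 l, l \in L & \big[minn/k]_(i <- L) F i = F l.
Proof.
elim: L => [|i L IH]; first by left; rewrite big_nil.
rewrite big_cons minnC /minn; case: ifP => _; last by right; exists i; rewrite ?mem_head.
by case: IH => [|[l hl e]]; [left | right; exists l; rewrite // inE hl orbT].
Qed.

Lemma mem_nonzero_upto d l :
  (l \in nonzero_upto d) = (0 < `|l|%N <= d).
Proof.
rewrite mem_cat; apply/orP/idP => [[]/mapP[x]|hl].
- by rewrite mem_iota => h ->; lia.
- by rewrite mem_iota => h ->; lia.
case: (lerP 0 l)%R => h; [left|right]; apply/mapP; exists `|l|%N; rewrite ?mem_iota; lia.
Qed.

Lemma inv_mod_correct s k : 1 < k -> coprime s k ->
  exists z, s * inv_mod k (sbar s k) = z * k + 1.
Proof.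
move=> k1 co; set v := inv_mod _ _.
suff h : s * v = 1 %[mod k].
  by exists (s * v %/ k); rewrite {1}(divn_eq (s * v) k) h modn_small.
have : has (fun x => sbar s k * x == 1 %[mod k]) (iota 0 k).
  have s0 : 0 < s by case: (s) co => //; rewrite /coprime gcd0n; lia.
  have [[u w] /= e] := coprimeP k s0 co.
  apply/hasP; exists (u %% k); first by rewrite mem_iota ltn_mod; lia.
  rewrite modnMmr modnMml mulnC; apply/eqP.
  by rewrite (_ : u * s = w * k + 1) ?modnMDl //; lia.
move=> hh; have := nth_find 0 hh; rewrite nth_iota; last first.
  by rewrite -[ltnRHS](size_iota 0) -has_find.
by rewrite add0n modnMml => /eqP.
Qed.

Section STilde.

Variables (s k d : nat).
Hypotheses (d_gt0 : 0 < d) (d_ltk : d < k) (co : coprime s k).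

Let st := stilde s k d.

(** Multiplying the close pair by the inverse of [s] shows that [n] is congruent to [l] or [-l]
    times that inverse, so [n] modulo [k] is among the values minimised. *)
Lemma stilde_min n m l : close_multiples s k d n m l -> st <= n.
Proof.
move=> [hl nm]; have [|z ez] := @inv_mod_correct s k _ co; first by lia.
move: ez; set v := inv_mod _ _ => ez.
suff [w hw ew] : exists2 w : int, w \in nonzero_upto d &
    ((w * v%:Z)%R %% k)%Z = (n%:Z %% k)%Z.
  apply: leq_trans (bigminn_le _ _ hw) _; rewrite -/v ew modz_nat absz_nat.
  exact: leq_mod.
have E1 : n * s * v = n + n * z * k by rewrite -mulnA ez; lia.
case: nm => e.
  exists (Posz l); first by rewrite mem_nonzero_upto; lia.
  have -> : (n%:Z = (m%:Z * v - n%:Z * z) * k%:Z + l%:Z * v)%R by rewrite e in E1; lia.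
  by rewrite modzMDl.
exists (- Posz l)%R; first by rewrite mem_nonzero_upto; lia.
have -> : (n%:Z = (m%:Z * v - n%:Z * z) * k%:Z + (- l%:Z) * v)%R.
  have : n * s * v + l * v = m * k * v by rewrite -e mulnDl.
  by lia.
by rewrite modzMDl.
Qed.

Lemma stilde_lt : st < k.
Proof.
have k0 : 0 < k by lia.
apply: (@leq_ltn_trans (`|(1 * (inv_mod k (sbar s k))%:Z)%R %% k|)%Z).
  by apply: bigminn_le; rewrite mem_nonzero_upto.
have := @ltz_pmod (1 * (inv_mod k (sbar s k))%:Z)%R k.
have := @modz_ge0 (1 * (inv_mod k (sbar s k))%:Z)%R k.
by lia.
Qed.

(** If the minimum is attained at [l], then [s * st] is congruent to [l]; the residue is [l] for
    positive [l] and [k - |l|] for negative [l]. *)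
Lemma stilde_residue : let r := s * st %% k in 0 < r /\ (r <= d \/ k <= r + d).
Proof.
have [|z ez] := @inv_mod_correct s k _ co; first by lia.
have := stilde_lt; rewrite /st /stilde.
case: (bigminn_attained (nonzero_upto d)
  (fun l => `|((l * (inv_mod k (sbar s k))%:Z)%R %% Posz k)%Z|%N)
  k) => [->|[l hl ->] _]; first by lia.
move: ez; set v := inv_mod _ _ => ez; rewrite mem_nonzero_upto in hl.
set x := (l * v%:Z)%R; pose u := `|(x %% k)%Z|%N; rewrite -/u.
have eu : (u%:Z = x - (x %/ k)%Z * k%:Z)%R.
  by have := divz_eq x k; have := @modz_ge0 x k; rewrite /u; lia.
have {eu} E : (s%:Z * u%:Z = l + k%:Z * (l * z%:Z - (x %/ k)%Z * s%:Z))%R.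
  rewrite eu /x; set q := ((_ %/ _)%Z).
  have e : (s%:Z * v%:Z = z%:Z * k%:Z + 1)%R by lia.
  have : (l * (s%:Z * v%:Z) = l * (z%:Z * k%:Z + 1))%R by rewrite e.
  by lia.
move: E; set w := (_ - _)%R => E.
have k0 : (0 < k%:Z)%R by lia.
case: (lerP 0 l)%R => h.
  have w0 : (0 <= w)%R by nia.
  have -> : s * u = `|w|%N * k + `|l|%N by nia.
  by rewrite modnMDl modn_small; lia.
have w0 : (0 < w)%R by nia.
have -> : s * u = `|w|%N.-1 * k + (k - `|l|%N) by nia.
by rewrite modnMDl modn_small; lia.
Qed.

(** Write [s = q * k + sb] and [sb * st = f * k + r]. As [sb > 0], the floor in B is [q]; the
    ceiling is [f], plus one unless [r = 1]; and [s * st %/ k = q * st + f]. *)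
Lemma BvalE : let r := s * st %% k in
  Bval s k d = Posz (s * (st + s * st %/ k + (r != 1))).
Proof.
have [r_gt0 _] := stilde_residue; have r_ltk : s * st %% k < k by rewrite ltn_mod; lia.
move=> r; rewrite /Bval -/st -/r in r_gt0 r_ltk *.
set q := s %/ k; set sb := sbar s k; set f := sb * st %/ k.
have es : s = q * k + sb by exact: divn_eq.
have ef : sb * st = f * k + r by rewrite {1}(divn_eq (sb * st) k) /r /sb /sbar modnMml.
have sb0 : 0 < sb by rewrite lt0n; apply/eqP => z; move: ef; rewrite z mul0n; lia.
have sbk : sb < k by rewrite ltn_mod; lia.
have em : s * st %/ k = q * st + f.
  have -> : s * st = (q * st + f) * k + r by rewrite {1}es mulnDl ef; lia.
  by rewrite divnMDl ?divn_small ?addn0 //; lia.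
have -> : ((s%:Z - 1) %/ k)%Z = q.
  have -> : (s%:Z - 1 = q%:Z * k%:Z + (sb%:Z - 1))%R by lia.
  by rewrite divzMDl ?divz_small; lia.
have -> : cdivz (sb%:Z * st%:Z - 1) k = f + (r != 1).
  rewrite /cdivz; case: eqP => [r1|r1] /=.
    have -> : (- (sb%:Z * st%:Z - 1) = (- f%:Z) * k%:Z)%R by lia.
    by rewrite mulzK; lia.
  have -> : (- (sb%:Z * st%:Z - 1) = (- f%:Z - 1) * k%:Z + (k%:Z - r%:Z + 1))%R by lia.
  by rewrite divzMDl ?divz_small; lia.
rewrite em; move: (nat_of_bool _) => b; clear ef em.
have : ((q%:Z * k%:Z + sb%:Z) = s%:Z)%R by lia.
by lia.
Qed.

End STilde.

(** * The maximal hook length *)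

(** Here the threshold is [T = (st + m0) * s = m0 * (s + k) + r]. Any [x >= T] forces the close pair
    [x - T], [x - T + r]. For [r = 1], [T - 1] is a multiple of [s + k] and drops out. *)
Lemma max_hook_length_above s k d st m0 r : 2 <= s -> 0 < d -> d < k ->
  0 < st < k -> coprime s k ->
  (forall n m l, close_multiples s k d n m l -> st <= n) ->
  st * s = m0 * k + r -> 0 < r <= d ->
  is_max_hook_length s k d (Posz ((st + m0) * s - (if r == 1 then 2 else 1))).
Proof.
move=> s2 d0 dk /andP[st0 stk] co smin e hr; set j := if _ then _ else _.
have T2 : j <= (st + m0) * s.
  have : 1 * s <= (st + m0) * s by rewrite leq_mul2r; lia.
  by rewrite /j; case: ifP; lia.
have thr : threshold s k st m0 = (st + m0) * s by rewrite /threshold; lia.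
have m0c : (exists2 r, 0 < r <= d & st * s = m0 * k + r) \/
  (exists2 e, 0 < e <= d & e + d < k /\ st * s + e = m0 * k) by left; exists r.
apply: is_max_hook_lengthI; first by lia.
- move=> a c E.
  apply: (threshold_minus_gap_above (j := j) (a := a) (c := c) dk st0 stk smin e hr) => //.
  + by rewrite /j; case: ifP.
  + by rewrite /j; case: ifP; lia.
  + by rewrite /j; case: ifP; lia.
  + by lia.
- move=> y y' a c a' c' E E'; apply/negP => hy.
  have := close_pair_threshold dk smin m0c E E' hy.
  by rewrite thr /j; case: ifP; lia.
move=> P x cP Px; have [P0 _ _ Pd] := cP.
have ltT : x < (st + m0) * s.
  rewrite ltnNge; apply/negP => h.
  have h1 : P (x - (st + m0) * s).
    apply: (@core_set_sub s k d P _ (st + m0) 0 cP).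
    by rewrite mul0n addn0 subnK.
  have h2 : P (x - (st + m0) * s + r).
    apply: (@core_set_sub s k d P _ 0 m0 cP).
    by rewrite mul0n addn0 (_ : _ + _ = x) //; lia.
  by have := Pd _ _ h1 h2; lia.
rewrite /j; case: eqP => r1; last by lia.
have : x != m0 * (s + k).
  apply: contraNneq P0 => ex.
  by apply: (@core_set_sub s k d P 0 0 m0 cP); rewrite mul0n !add0n -ex.
by lia.
Qed.

(** The mirror case [T = m0 * (s + k) = (st + m0) * s + e]: for [e = 1] it is a multiple of [s] that
    equals [T - 1]. *)
Lemma max_hook_length_below s k d st m0 e : 2 <= s -> 0 < d -> d < k ->
  0 < st < k -> coprime s k ->
  (forall n m l, close_multiples s k d n m l -> st <= n) ->
  st * s + e = m0 * k -> 0 < e <= d -> e + d < k ->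
  is_max_hook_length s k d (Posz (m0 * (s + k) - (if e == 1 then 2 else 1))).
Proof.
move=> s2 d0 dk /andP[st0 stk] co smin eq he hek; set j := if _ then _ else _.
have m0_gt0 : 0 < m0 by rewrite lt0n; apply/eqP => z; move: eq; rewrite z mul0n; lia.
have T2 : j <= m0 * (s + k).
  have : 1 * (s + k) <= m0 * (s + k) by rewrite leq_mul2r; lia.
  by rewrite /j; case: ifP; lia.
have thr : threshold s k st m0 = m0 * (s + k) by rewrite /threshold; lia.
have m0c : (exists2 r, 0 < r <= d & st * s = m0 * k + r) \/
  (exists2 e, 0 < e <= d & e + d < k /\ st * s + e = m0 * k) by right; exists e.
apply: is_max_hook_lengthI; first by lia.
- move=> a c E.
  apply: (threshold_minus_gap_below (j := j) (a := a) (c := c) s2 dk st0 stk smin eq he hek) => //.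
  + by rewrite /j; case: ifP.
  + by rewrite /j; case: ifP; lia.
  + by rewrite /j; case: ifP; lia.
  + by lia.
- move=> y y' a c a' c' E E'; apply/negP => hy.
  have := close_pair_threshold dk smin m0c E E' hy.
  by rewrite thr /j; case: ifP; lia.
move=> P x cP Px; have [P0 _ _ Pd] := cP.
have ltT : x < m0 * (s + k).
  rewrite ltnNge; apply/negP => h.
  have h1 : P (x - m0 * (s + k)).
    apply: (@core_set_sub s k d P _ 0 m0 cP).
    by rewrite mul0n addn0 subnK.
  have h2 : P (x - m0 * (s + k) + e).
    apply: (@core_set_sub s k d P _ (st + m0) 0 cP).
    by rewrite mul0n addn0 (_ : _ + _ = x) //; lia.
  by have := Pd _ _ h1 h2; lia.
rewrite /j; case: eqP => r1; last by lia.
have : x != (st + m0) * s.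
  apply: contraNneq P0 => ex.
  by apply: (@core_set_sub s k d P 0 (st + m0) 0 cP); rewrite mul0n add0n addn0 -ex.
by lia.
Qed.

(** For [x >= s] and [s <= d], [x] and [x - s] are too close. For [k = 1], [x - s] is 0 or has the
    neighbour [x - (s + 1)]. *)
Lemma max_hook_length_small s k d : 2 <= s -> 0 < d -> 0 < k ->
  (k == 1) || (k <= d) && (s <= d) -> is_max_hook_length s k d (Posz s.-1).
Proof.
move=> s2 d0 k0 hk; apply: is_max_hook_lengthI; first by lia.
- move=> [|a] [|c]; rewrite ?mulSn; lia.
- move=> y y' [|a] [|c] [|a'] [|c']; rewrite ?mulSn; lia.
move=> P x cP Px; have [P0 Ps Pt Pd] := cP; rewrite -ltnS prednK; last by lia.
rewrite ltnNge; apply/negP => h.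
have h1 := Ps _ Px h.
case/orP: hk => [/eqP k1|/andP[kd sd]]; last by have := Pd _ _ h1 Px; lia.
case: (leqP (s + k) x) => h2; first by have := Pd _ _ (Pt _ Px h2) h1; lia.
by move: h1; rewrite (_ : x - s = 0) ?(negPf P0) //; lia.
Qed.

(** From [s + k] on, [x - s] and [x - (s + k)] are only [k <= d] apart; [s + k - 1] reaches only
    itself and [k - 1], at distance [s > d]. *)
Lemma max_hook_length_medium s k d : 1 < k <= d -> d < s ->
  is_max_hook_length s k d (Posz (s + k).-1).
Proof.
move=> hk ds; apply: is_max_hook_lengthI; first by lia.
- by move=> [|[|a]] [|c]; rewrite ?mulSn; lia.
- by move=> y y' [|[|a]] [|c] [|[|a']] [|c']; rewrite ?mulSn; lia.
move=> P x cP Px; have [P0 Ps Pt Pd] := cP; rewrite -ltnS prednK; last by lia.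
rewrite ltnNge; apply/negP => h.
have h1 := Pt _ Px h; have h2 := Ps _ Px (leq_trans (leq_addr _ _) h).
by have := Pd _ _ h1 h2; lia.
Qed.

Theorem theorem1p1 (s k d : nat) (hs : 2 <= s) (hk : 0 < k) (hd : 0 < d)
    (hsk : coprime s k) :
  is_max_hook_length s k d (max_hook_formula s k d).
Proof.
rewrite /max_hook_formula.
case: ifP => [c1|/negbT c1].
  have -> : (s%:Z - 1 = s.-1)%R by lia.
  exact: max_hook_length_small.
case: ifP => [/andP[c2 c3]|/negbT c2].
  have -> : (s%:Z + k%:Z - 1 = (s + k).-1)%R by lia.
  exact: max_hook_length_medium.
have dk : d < k by lia.
have [r0 hr] := stilde_residue hd dk hsk.
have stk := stilde_lt hd dk hsk.
have smin := @stilde_min s k d hd dk hsk.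
rewrite /sbar modnMml (BvalE hd dk hsk) dk andbT /=.
have rk : s * stilde s k d %% k < k by rewrite ltn_mod.
have e := divn_eq (s * stilde s k d) k.
move: (stilde s k d) (s * stilde s k d %/ k) (s * stilde s k d %% k)
  e r0 hr stk smin rk => st m r e r0 hr stk smin rk.
have st0 : 0 < st by rewrite lt0n; apply/eqP => z; move: e; rewrite z muln0; lia.
have st_bounds : 0 < st < k by lia.
case: (leqP r d) => rd.
  (* Here [m0 = m] and [B] is the threshold when [r = 1], the threshold plus [s] otherwise. *)
  have e' : st * s = m * k + r by lia.
  have := max_hook_length_above hs hd dk st_bounds hsk smin e'; rewrite r0 rd => /(_ isT).
  have h1 : 1 * s <= (st + m) * s by rewrite leq_mul2r; lia.
  case: (eqVneq r 1) => [r1|r1]; congr is_max_hook_length; first by rewrite addn0; lia.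
  have -> : 1 < r by lia.
  by rewrite /=; lia.
(* Now [r >= k - d], so [m0 = m.+1] and [e = k - r]; [r > d] is exactly [e + d < k]. The threshold
   is [B + k - r]. *)
have e' : st * s + (k - r) = m.+1 * k by lia.
have := max_hook_length_below hs hd dk st_bounds hsk smin e' ltac:(lia) ltac:(lia).
have -> : (r == 1) = false by lia.
rewrite andbF /=.
case: (ltnP r k.-1) => rk1.
  have -> : (k - r == 1) = false by lia.
  by congr is_max_hook_length; lia.
have -> : k - r == 1 by lia.
have -> : r == k.-1 by lia.
by congr is_max_hook_length; lia.
Qed.
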